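(* Let $\mathbb{F}_q$ be a finite field with $q$ elements of odd characteristic, let $Q$ be a non-degenerate quadratic form on $\mathbb{F}_q^3$, let $j\in\mathbb{F}_q$, and let $\mathcal{S}^2_j=\{\boldsymbol{\xi}\in\mathbb{F}_q^3: Q(\boldsymbol{\xi})=j\}$, equipped with its normalized counting measure $\sigma$. Suppose that $-j\det(Q)\neq 0$ and that $-j\det(Q)$ is not a square in $\mathbb{F}_q^\times$. Then for every function $f:\mathcal{S}^2_j\to\mathbb{C}$, $$\|(f\sigma)^{\vee}\|^4_{L^4(\mathbb{F}_q^3,d\boldsymbol{x})}\leq \frac{q^3}{|\mathcal{S}^2_j|^2}\left(q+1-\frac{3q}{|\mathcal{S}^2_j|}\right)\|f\|^4_{L^2(\mathcal{S}^2_j,d\sigma)}.$$ This inequality is sharp (the constant on the right-hand side cannot be replaced by a smaller one), and equality holds if $f$ is a constant function. Moreover, any maximizer $f$ of this inequality has constant modulus, i.e. $|f|$ is constant on $\mathcal{S}^2_j$.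
   Context: A quadratic form on $\mathbb{F}_q^3$ is written $Q(\boldsymbol{\xi})=\sum_{i,k=1}^3 a_{ik}\xi_i\xi_k$ with $a_{ik}=a_{ki}\in\mathbb{F}_q$; the symmetric matrix $(a_{ik})$ is also denoted $Q$, and $\det(Q)$ is its determinant. The form is non-degenerate if this matrix is invertible. Fix a non-principal (nontrivial) additive character $\chi:\mathbb{F}_q\to\{z\in\mathbb{C}:|z|=1\}$. For a nonempty finite set $\mathcal{S}\subset\mathbb{F}_q^3$ and $f:\mathcal{S}\to\mathbb{C}$, define for $\boldsymbol{x}\in\mathbb{F}_q^3$ $$(f\sigma)^\vee(\boldsymbol{x})=\frac{1}{|\mathcal{S}|}\sum_{\boldsymbol{\xi}\in\mathcal{S}}f(\boldsymbol{\xi})\chi(\boldsymbol{\xi}\cdot\boldsymbol{x}),\qquad \boldsymbol{\xi}\cdot\boldsymbol{x}=\xi_1x_1+\xi_2x_2+\xi_3x_3.$$ Norms: $d\boldsymbol{x}$ is counting measure, so $\|g\|_{L^4(\mathbb{F}_q^3,d\boldsymbol{x})}^4=\sum_{\boldsymbol{x}\in\mathbb{F}_q^3}|g(\boldsymbol{x})|^4$; $\sigma$ is normalized counting measure on $\mathcal{S}$, so $\|f\|_{L^2(\mathcal{S},d\sigma)}^2=\frac{1}{|\mathcal{S}|}\sum_{\boldsymbol{\xi}\in\mathcal{S}}|f(\boldsymbol{\xi})|^2$. $|\cdot|$ of a set denotes cardinality, and $\mathbb{F}_q^\times=\mathbb{F}_q\setminus\{0\}$. A maximizer is a nonzero function $f$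 for which equality holds. *)

(* Defs.v *)
From HB Require Import structures.
From mathcomp Require Import all_boot all_order all_algebra.
From mathcomp Require Import reals complex.

Set Implicit Arguments.
Unset Strict Implicit.
Unset Printing Implicit Defensive.

Import Order.TTheory GRing.Theory Num.Theory.
Local Open Scope ring_scope.

(* For R : realType, R[i] is the field of complex numbers. Its norm takes
   values in R[i], and x <= y in R[i] means that y - x is a nonnegative real. *)

Section Quadric.
Variable F : finFieldType.

Definition dot (xi x : 'rV[F]_3) : F := \sum_i xi 0 i * x 0 i.

Definition qform (Q : 'M[F]_3) (xi : 'rV[F]_3) : F :=
  \sum_i \sum_k Q i k * xi 0 i * xi 0 k.

Definition quadric (Q : 'M[F]_3) (j : F) : {set 'rV[F]_3} :=
  [set xi | qform Q xi == j].

End Quadric.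

Section Extension.
Variables (R : realType) (F : finFieldType).

Definition additive_character (chi : F -> R[i]) : Prop :=
  (forall x, `|chi x| = 1) /\ {morph chi : x y / x + y >-> x * y}.

Definition nonprincipal (chi : F -> R[i]) : Prop := exists x, chi x <> 1.

Definition extension (chi : F -> R[i]) (S : {set 'rV[F]_3})
    (f : {xi | xi \in S} -> R[i]) (x : 'rV[F]_3) : R[i] :=
  #|S|%:R^-1 * \sum_xi f xi * chi (dot (val xi) x).

Definition L4norm (g : 'rV[F]_3 -> R[i]) : R[i] :=
  4.-root (\sum_x `|g x| ^+ 4).

Definition L2norm (S : {set 'rV[F]_3}) (f : {xi | xi \in S} -> R[i]) : R[i] :=
  sqrtC (#|S|%:R^-1 * \sum_xi `|f xi| ^+ 2).

Definition sharp_constant (S : {set 'rV[F]_3}) : R[i] :=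
  #|F|%:R ^+ 3 / #|S|%:R ^+ 2 * (#|F|%:R + 1 - 3 * #|F|%:R / #|S|%:R).

Definition maximizer (chi : F -> R[i]) (S : {set 'rV[F]_3})
    (f : {xi | xi \in S} -> R[i]) : Prop :=
  (exists xi, f xi <> 0) /\
  L4norm (extension chi f) ^+ 4 = sharp_constant S * L2norm f ^+ 4.

End Extension.

Arguments sharp_constant R {F} S.

(* Main.v *)
Require Import Defs.
From HB Require Import structures.
From mathcomp Require Import all_boot all_order all_algebra.
From mathcomp Require Import reals complex.
From mathcomp Require Import ring zify.

(* Parseval turns ||(f sigma)^vee||_4^4 into the energies
   E = sum_s |sum_a f(a) f(s-a)|^2 = sum_s |sum_a f(a) f(a-s)^*|^2.
   Cauchy-Schwarz for each s <> 0 in both expressions, followed by averaging,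
   bounds E by a quadratic form in the even part e of |f|^2 with kernel
   rho(a-b), where rho(s) counts the points v of S with v - s in S. In
   hyperbolic coordinates S is {y^2 + x z = delta} with delta a nonsquare, and
   rho(a-b) = q+1 - #{tangent planes of the null cone containing a-b}
   - q [a = -b] for distinct a, b in S. So the form equals
   (q+2) L^2 - sum_l sum_c (sum_{l(a)=c} e(a))^2 - q sum_a e(a)^2 with
   L = sum e, where l runs over q+1 functionals that do not vanish on S. Two
   more applications of Cauchy-Schwarz to the subtracted sums give the sharp
   constant, with equality only for constant e; and equality at s = 0 forces
   |f| to be even. *)

Set Implicit Arguments.
Unset Strict Implicit.
Unset Printing Implicit Defensive.

Import Order.TTheory GRing.Theory Num.Theory.
Local Open Scope ring_scope.

(** * Conics over a finite field *)

Section FiniteField.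
Variable F : finFieldType.

Definition sqroots (D : F) : {set F} := [set t | t ^+ 2 == D].

Lemma card_sqroots_le2 D : (#|sqroots D| <= 2)%N.
Proof.
have [->|[t]] := set_0Vmem (sqroots D); first by rewrite cards0.
rewrite inE => /eqP tD.
have /subset_leq_card/leq_trans : sqroots D \subset [set t; - t].
  by apply/subsetP => u; rewrite !inE -tD eqf_sqr.
by apply; rewrite cards2; case: (_ != _).
Qed.

Lemma card_sqroots0 : #|sqroots 0| = 1%N.
Proof.
apply/eqP/cards1P; exists 0; apply/setP => t.
by rewrite !inE sqrf_eq0.
Qed.

(** Squaring has fibres of size at most two, and the fibre over [0] has size one, which makes the
    inequality strict. *)
Lemma card_squares : (#|F| < 2 * #|[set t ^+ 2 | t : F]|)%N.
Proof.
set Sq := [set _ | t : F].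
have Sq0 : 0 \in Sq by apply/imsetP; exists 0; rewrite ?expr0n.
have -> : #|F| = (\sum_(D in Sq) #|sqroots D|)%N.
  rewrite -sum1_card (partition_big (fun t : F => t ^+ 2) (mem Sq)) /=.
    by apply: eq_bigr => D _; rewrite -sum1_card; apply: eq_bigl => t; rewrite inE.
  by move=> t _; apply/imsetP; exists t.
rewrite (bigD1 0) //= card_sqroots0.
have eq2 : (\sum_(D in Sq) 2 = 2 + \sum_(D in Sq | D != 0%R) 2)%N by rewrite (bigD1 0).
rewrite [LHS]sum_nat_const in eq2.
rewrite mulnC eq2 ltnS leq_add2l; apply: leq_sum => D _; exact: card_sqroots_le2.
Qed.

(** The values of [a * x ^+ 2] and those of [k - b * y ^+ 2] each fill more than half of the field,
    so the two sets meet. *)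
Lemma binary_form_universal (a b k : F) : a != 0 -> b != 0 ->
  exists x y, a * x ^+ 2 + b * y ^+ 2 = k.
Proof.
move=> a0 b0; set Sq := [set t ^+ 2 | t : F].
set A := [set a * D | D in Sq]; set B := [set k - b * D | D in Sq].
have cA : #|A| = #|Sq| by apply: card_imset; exact: mulfI.
have cB : #|B| = #|Sq|.
  by apply: card_imset => x y /subrI/(mulfI b0).
have [AB|[u]] := set_0Vmem (A :&: B).
  have := max_card (mem (A :|: B)).
  by rewrite cardsU AB cards0 cA cB subn0 addnn -mul2n leqNgt card_squares.
rewrite inE => /andP[/imsetP[_ /imsetP[x _ ->] ->] /imsetP[_ /imsetP[y _ ->] e]].
by exists x, y; rewrite e subrK.
Qed.

Definition conic (D k : F) : {set F * F} :=
  [set p | p.1 ^+ 2 - D * p.2 ^+ 2 == k].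

(* The norm of [w + x sqrt D] is multiplicative and represents [k' / k], so
   multiplication by an element of that norm maps one conic into the other. *)
Lemma card_conic_le D k k' : D != 0 -> k != 0 -> k' != 0 ->
  (#|conic D k| <= #|conic D k'|)%N.
Proof.
move=> D0 k0 k'0.
have [w [x e]] : exists w x, 1 * w ^+ 2 + (- D) * x ^+ 2 = k' / k.
  by apply: binary_form_universal; rewrite ?oppr_eq0 ?oner_eq0.
rewrite mul1r mulNr in e.
pose g (p : F * F) := (p.1 * w + D * p.2 * x, p.1 * x + p.2 * w).
pose g' (p : F * F) := (p.1 * w - D * p.2 * x, - p.1 * x + p.2 * w).
have gK p : g' (g p) = (p.1 * (k' / k), p.2 * (k' / k)).
  by rewrite /g' /g /= -e; congr (_, _); ring.
have ginj : injective g.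
  move=> p1 p2 /(congr1 g'); rewrite !gK.
  have kk : k' / k != 0 by rewrite mulf_neq0 ?invr_neq0.
  by case: p1 p2 => [? ?] [? ?] /= [/(mulIf kk)-> /(mulIf kk)->].
rewrite -(card_imset _ ginj); apply/subset_leq_card/subsetP => _ /imsetP[p + ->].
rewrite !inE /= => /eqP pk; apply/eqP.
transitivity ((p.1 ^+ 2 - D * p.2 ^+ 2) * (w ^+ 2 - D * x ^+ 2)); first by ring.
by rewrite pk e mulrC divfK.
Qed.

(** The zero set consists of the origin and, for each square root [t] of [D], the nonzero points of
    the line [w = t x]. *)
Lemma card_conic0 D : D != 0 ->
  #|conic D 0| = (1 + #|F|.-1 * #|sqroots D|)%N.
Proof.
move=> D0.
pose g (p : F * F) := (p.1 * p.2, p.1).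
have -> : conic D 0 = (0, 0) |: [set g p | p in setX [set~ 0] (sqroots D)].
  apply/setP => -[w x]; rewrite !inE /= xpair_eqE.
  have [->|x0] := eqVneq x 0.
    rewrite expr0n /= mulr0 subr0 sqrf_eq0 andbT.
    case: eqP => //= _; symmetry; apply/negbTE/imsetP => -[[a t]].
    by rewrite !inE => /andP[/= a0 _] [_ a0']; rewrite -a0' eqxx in a0.
  rewrite andbF /=; apply/eqP/imsetP => [e|[[a t]]].
    exists (x, w / x); last by rewrite /g /= mulrC divfK.
    by rewrite !inE x0 /= expr_div_n (subr0_eq e) mulfK // expf_neq0.
  rewrite !inE => /andP[/= a0 /eqP<-] [-> ->]; ring.
rewrite cardsU1 card_in_imset ?cardsX ?cardsC1 ?card_ord.
  congr (_ + _)%N; suff -> : (0, 0) \notin [set g p | p in setX [set~ 0] (sqroots D)] by [].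
  apply/imsetP => -[[a t]].
  by rewrite !inE => /andP[/= a0 _] [_ a0']; rewrite -a0' eqxx in a0.
move=> [a t] [a' t']; rewrite !inE /= => /andP[/= a0 _] _ [+ e].
by rewrite /g /= -e => /(mulfI a0)->.
Qed.

(** By [card_conic_le] the [q - 1] conics with nonzero right-hand side have a common size [N].
    Counting all pairs gives [q^2 = 1 + (q - 1) r + (q - 1) N], with [r] the number of square roots
    of [D], and [q - 1] cancels. *)
Lemma card_conic D k : D != 0 -> k != 0 ->
  (#|conic D k| + #|sqroots D| = #|F|.+1)%N.
Proof.
move=> D0 k0.
have F1 : (1 < #|F|)%N by apply: card_finNzRing_gt1.
have : (#|F| * #|F| = \sum_(k' : F) #|conic D k'|)%N.
  rewrite -card_prod -sum1_card.
  rewrite (partition_big (fun p : F * F => p.1 ^+ 2 - D * p.2 ^+ 2) xpredT) //=.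
  by apply: eq_bigr => k' _; rewrite -sum1_card; apply: eq_bigl => t; rewrite inE.
rewrite (bigD1 0) //= card_conic0 //.
rewrite (eq_bigr (fun _ => #|conic D k|)); last first.
  by move=> k' k'0; apply/eqP; rewrite eqn_leq !card_conic_le.
rewrite sum_nat_const; have -> : #|[pred k' : F | k' != 0]| = #|F|.-1.
  by rewrite -(cardsC1 (0 : F)); apply: eq_card => t; rewrite !inE.
move: F1; case: #|F| => [//|[//|n]] _ /=; nia.
Qed.

End FiniteField.

(** * The elliptic quadric *)

Section EllipticQuadric.
Variables (F : finFieldType) (V : finZmodType) (X Y Z : V -> F).
Variables (mk : F -> F -> F -> V) (delta : F).
Hypothesis two_neq0 : (2 : F) != 0.
Hypothesis XB : {morph X : u v / u - v}.
Hypothesis YB : {morph Y : u v / u - v}.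
Hypothesis ZB : {morph Z : u v / u - v}.
Hypothesis mkX : forall x y z, X (mk x y z) = x.
Hypothesis mkY : forall x y z, Y (mk x y z) = y.
Hypothesis mkZ : forall x y z, Z (mk x y z) = z.
Hypothesis mkK : forall v, mk (X v) (Y v) (Z v) = v.
Hypothesis nonsquare : forall t, t ^+ 2 != delta.

Definition ellquad : {set V} := [set v | Y v ^+ 2 + X v * Z v == delta].

(* The tangent planes of the null cone [y ^ 2 + x z = 0] through the origin
   are the kernels of these [q + 1] functionals; [None] is the point at
   infinity of the conic of null directions. *)
Definition tangent (i : option F) (v : V) : F :=
  if i is Some m then Z v + 2 * m * Y v - m ^+ 2 * X v else X v.

Definition overlap (s : V) : {set V} :=
  [set v in ellquad | v - s \in ellquad].

Lemma tangentB i : {morph tangent i : u v / u - v}.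
Proof. by case: i => [m|] u v /=; rewrite ?XB ?YB ?ZB //; ring. Qed.

Lemma ellquad_X v : v \in ellquad -> X v != 0.
Proof.
rewrite inE; apply: contraTneq => ->; rewrite mul0r addr0; exact: nonsquare.
Qed.

(** On the kernel of a tangent functional [y^2 + x z] is a square, namely [y^2] or [(y - m x)^2], so
    it never equals [delta]. *)
Lemma tangent_neq0 i v : v \in ellquad -> tangent i v != 0.
Proof.
case: i => [m|] /=; last exact: ellquad_X.
rewrite inE; apply: contraTneq => e.
have -> : Z v = m ^+ 2 * X v - 2 * m * Y v.
  by rewrite -[Z v]subr0 -e; ring.
by have := nonsquare (Y v - m * X v); congr (~~ (_ == _)); ring.
Qed.

Lemma coordinatesN v : [/\ X (- v) = - X v, Y (- v) = - Y v & Z (- v) = - Z v].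
Proof.
by split; rewrite -[- v]sub0r -[in LHS](subrr v) ?XB ?YB ?ZB subrr sub0r.
Qed.

Lemma ellquadN v : v \in ellquad -> - v \in ellquad.
Proof. by rewrite !inE; have [-> -> ->] := coordinatesN v; rewrite sqrrN mulrNN. Qed.

Lemma coordinates_inj u v : X u = X v -> Y u = Y v -> Z u = Z v -> u = v.
Proof. by move=> ex ey ez; rewrite -(mkK u) ex ey ez mkK. Qed.

Lemma coordinates0 : [/\ X 0 = 0, Y 0 = 0 & Z 0 = 0].
Proof. by split; rewrite -(subrr 0) ?XB ?YB ?ZB subrr. Qed.

(** On the plane where the functional equals [c], the quadric becomes the parabola
    [t^2 + c x = delta] with [t = y - m x], or [t^2 + c z = delta] with [t = y] for [None]; [t] is a
    free parameter. *)
Lemma card_tangent_fiber i (c : F) : c != 0 ->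
  #|[set v in ellquad | tangent i v == c]| = #|F|.
Proof.
move=> c0; pose xof (t : F) := (delta - t ^+ 2) / c.
pose g t := if i is Some m then
    mk (xof t) (t + m * xof t) (c - 2 * m * (t + m * xof t) + m ^+ 2 * xof t)
  else mk c t (xof t).
have -> : [set v in ellquad | tangent i v == c] = [set g t | t : F].
  apply/setP => v; rewrite !inE; apply/andP/imsetP => [[/eqP e1 /eqP e2]|[t _ ->]].
    rewrite {}/g {}/xof; case: i e2 => [m|] /= e2; last first.
      exists (Y v) => //; have -> : (delta - Y v ^+ 2) / c = Z v.
        by rewrite -e1 -e2 [Y v ^+ 2 + _]addrC addrK mulrC mulKf // e2.
      by rewrite -e2 mkK.
    exists (Y v - m * X v) => //.
    have -> : (delta - (Y v - m * X v) ^+ 2) / c = X v.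
      by rewrite -e1 -e2; field; rewrite e2.
    by rewrite -e2; apply: coordinates_inj; rewrite ?mkX ?mkY ?mkZ //; ring.
  rewrite {}/g {}/xof; case: i => [m|] /=; rewrite !mkX ?mkY !mkZ.
    by split; apply/eqP; field.
  by split=> //; apply/eqP; field.
rewrite card_imset //; rewrite {}/g => t t'.
case: i => [m|] e; last by rewrite -(mkY c t (xof t)) e mkY.
have := congr1 X e; rewrite !mkX => ex; have := congr1 Y e.
by rewrite !mkY ex; apply: addIr.
Qed.

Lemma card_ellquad : #|ellquad| = (#|F|.-1 * #|F|)%N.
Proof.
rewrite -sum1_card (partition_big X (fun c => c != 0)) /=; last exact: ellquad_X.
rewrite (eq_bigr (fun _ => #|F|)); last first.
  move=> c c0; rewrite -[RHS](card_tangent_fiber None c0) -sum1_card.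
  by apply: eq_bigl => v; rewrite [in RHS]inE.
rewrite sum_nat_const -(cardsC1 (0 : F)); congr (_ * _)%N.
by apply: eq_card => t; rewrite !inE.
Qed.

(** The value at [s] of the form defining the quadric; [4 * disc s] is also the discriminant of
    [tangent (Some m) s] as a polynomial in [m]. *)
Definition disc (s : V) : F := Y s ^+ 2 + X s * Z s.

(** Subtracting the equations of [v] and [v - s] cancels the terms quadratic in [v] and leaves a
    plane. *)
Lemma overlapE s v : (v \in overlap s) =
  (v \in ellquad) && (2 * Y s * Y v + X s * Z v + Z s * X v == disc s).
Proof.
rewrite /overlap in_set; case: (boolP (v \in _)) => //=; rewrite !inE XB YB ZB /disc => /eqP e.
rewrite -subr_eq0 -[RHS]subr_eq0 -oppr_eq0 -e; congr (_ == _); ring.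
Qed.

(** As [X s] is nonzero, the plane of [overlapE] determines [Z v]. Completing the square with
    [w = X s * Y v - Y s * X v] and [t = X v - X s / 2] turns the quadric into a conic in [w] and
    [t]. *)
Lemma card_overlap s : X s != 0 ->
  #|overlap s| = #|conic (disc s) (X s ^+ 2 * (delta - disc s / 4))|.
Proof.
move=> s0; have f0 : (4 : F) != 0 by rewrite (natrM _ 2 2) mulf_neq0.
pose x (p : F * F) := p.2 + X s / 2.
pose y p := (p.1 + Y s * x p) / X s.
pose g p := mk (x p) (y p) ((disc s - 2 * Y s * y p - Z s * x p) / X s).
have -> : overlap s = [set g p | p in conic (disc s) (X s ^+ 2 * (delta - disc s / 4))].
  apply/setP => v; rewrite overlapE; apply/andP/imsetP => [[]|[p]].
    rewrite inE => /eqP e1 /eqP e2.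
    exists (X s * Y v - Y s * X v, X v - X s / 2).
      rewrite inE /= -subr_eq0; apply/eqP.
      transitivity (X s ^+ 2 * (Y v ^+ 2 + X v * Z v - delta)
        + X s * X v * (disc s - (2 * Y s * Y v + X s * Z v + Z s * X v))).
        by rewrite /disc; field; rewrite f0.
      by rewrite e1 e2 !subrr !mulr0 addr0.
    have ex : x (X s * Y v - Y s * X v, X v - X s / 2) = X v by rewrite /x /= subrK.
    have ey : y (X s * Y v - Y s * X v, X v - X s / 2) = Y v.
      by rewrite /y ex /=; field.
    rewrite /g ex ey -[LHS]mkK; congr mk; rewrite -e2; field; exact: s0.
  rewrite !inE => /eqP e ->; rewrite /g !mkX !mkY !mkZ.
  split; last by apply/eqP; field.
  rewrite -subr_eq0; apply/eqP.
  apply: (mulfI (expf_neq0 2 s0)); rewrite mulr0.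
  transitivity (p.1 ^+ 2 - disc s * p.2 ^+ 2 - X s ^+ 2 * (delta - disc s / 4)).
    rewrite /y /x /disc; field; rewrite two_neq0 ?s0 ?f0 //.
  by rewrite e subrr.
rewrite card_imset // => -[w t] [w' t'] e.
have := congr1 Y e; have := congr1 X e; rewrite !mkX !mkY /y /x /= => /addIr ->.
by move/(mulIf (invr_neq0 s0))/addIr->.
Qed.

(** The roots in [m] of [tangent (Some m) s] are [(Y s + t) / X s] with [t] a square root of
    [disc s]; [None] drops out because [X s] is nonzero. *)
Lemma card_tangent_disc s : X s != 0 ->
  #|[set i | tangent i s == 0]| = #|sqroots (disc s)|.
Proof.
move=> s0; pose g t := Some ((Y s + t) / X s).
have -> : [set i | tangent i s == 0] = [set g t | t in sqroots (disc s)].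
  apply/setP => -[m|]; rewrite inE /=; last first.
    by rewrite (negbTE s0); apply/esym/negbTE/imsetP => -[].
  apply/eqP/imsetP => [e|[t]].
    exists (m * X s - Y s); last by rewrite /g addrC subrK mulfK.
    rewrite inE /disc -subr_eq0; apply/eqP.
    by transitivity (- X s * (Z s + 2 * m * Y s - m ^+ 2 * X s)); [ring | rewrite e mulr0].
  rewrite inE => /eqP e [->]; apply: (mulfI s0); rewrite mulr0.
  transitivity (disc s - t ^+ 2); last by rewrite e subrr.
  by rewrite /disc; field.
by rewrite card_imset // => t t' /Some_inj/(mulIf (invr_neq0 s0))/addrI.
Qed.

Lemma sqroots_nonsquare : sqroots (4 * delta) = set0.
Proof.
apply/setP => t; rewrite !inE; have := nonsquare (t / 2).
apply: contraNF => /eqP e; apply/eqP; rewrite expr_div_n e expr2 -natrM.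
by rewrite mulrC mulKf // (natrM _ 2 2) mulf_neq0.
Qed.

(* The points [v] of the quadric with [v - s] on the quadric form a plane conic
   whose points at infinity are the null directions orthogonal to [s], so there
   are [q + 1] of them in total unless the conic is singular, which happens only
   for [a = - b]. *)
Lemma card_overlap_tangent a b : a \in ellquad -> b \in ellquad -> a != b ->
  (#|overlap (a - b)%R| + #|[set i | tangent i (a - b) == 0]%R|
     + (if (a == - b)%R then #|F| else 0) = #|F|.+1)%N.
Proof.
move=> Sa Sb ab; set s := a - b.
have aO : a \in overlap s by rewrite in_set Sa /s opprB addrCA subrr addr0.
have := aO; rewrite overlapE Sa /= => /eqP ea.
have Xa := ellquad_X Sa.
have dE : a = - b -> [/\ X s = 2 * X a, Y s = 2 * Y a & Z s = 2 * Z a].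
  move=> e; have -> : s = a - - a by rewrite {2}e opprK.
  by rewrite XB YB ZB; have [-> -> ->] := coordinatesN a; split; ring.
have Sa' : Y a ^+ 2 + X a * Z a = delta by move: Sa; rewrite inE => /eqP.
have F1 : (1 < #|F|)%N by apply: card_finNzRing_gt1.
have f0 : (4 : F) != 0 by rewrite (natrM _ 2 2) mulf_neq0.
(* If [X s = 0], the reduction of [card_overlap] breaks down and the overlap is parametrized
   directly. *)
have [s0|s0] := eqVneq (X s) 0.
  have s1 : Y s != 0.
    apply: contraNneq ab => s1; move: ea; rewrite /disc s0 s1.
    rewrite expr0n /= !(mulr0, mul0r, add0r) => /eqP.
    rewrite mulf_eq0 (negbTE Xa) orbF => /eqP s2.
    rewrite -subr_eq0 -/s; apply/eqP.
    by have [x0 y0 z0] := coordinates0; apply: coordinates_inj; rewrite ?x0 ?y0 ?z0.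
  have -> : (a == - b) = false.
    apply/eqP => /dE[x0 _ _]; have := mulf_neq0 two_neq0 Xa.
    by rewrite -x0 s0 eqxx.
  have -> : [set i | tangent i s == 0] = [set None; Some (- Z s / (2 * Y s))].
    apply/setP => -[m|]; rewrite !inE /= s0 ?eqxx // mulr0 subr0.
    apply/eqP/eqP => [e|[->]]; last by field; rewrite s1.
    have -> : Z s = - (2 * m * Y s) by rewrite -[LHS]subr0 -e; ring.
    by congr Some; field; rewrite s1.
  rewrite cards2 /=.
  (* The plane gives [Y v] from [t = X v] and the quadric then gives [Z v]. Every [t != 0] occurs,
     so [q - 1] points join the two tangent functionals. *)
  pose y t := (disc s - Z s * t) / (2 * Y s).
  pose g t := mk t (y t) ((delta - y t ^+ 2) / t).
  have -> : overlap s = [set g t | t in [set~ 0]].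
    apply/setP => v; rewrite overlapE s0 mul0r addr0.
    apply/andP/imsetP => [[Sv /eqP e]|[t]].
      have Xv := ellquad_X Sv; move: Sv; rewrite inE => /eqP Sv.
      exists (X v); first by rewrite !inE.
      have ey : y (X v) = Y v by rewrite /y -e; field; rewrite s1.
      by rewrite /g ey -Sv [Y v ^+ 2 + _]addrC addrK mulrC mulKf.
    rewrite !inE => t0 ->; rewrite /g !mkX !mkY !mkZ; split; apply/eqP.
      by field.
    by rewrite /y; field; rewrite s1.
  rewrite card_in_imset ?cardsC1; first by rewrite addn0 addn2 prednK ?(ltnW F1).
  by move=> t t' _ _ /(congr1 X); rewrite !mkX.
rewrite card_overlap // card_tangent_disc //.
(* This says that the point of the plane conic coming from [a] lies on it. *)
have eD : X s ^+ 2 * (delta - disc s / 4) =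
    (X s * Y a - Y s * X a) ^+ 2 - disc s * (X a - X s / 2) ^+ 2.
  apply/eqP; rewrite -subr_eq0; apply/eqP.
  transitivity (- X s ^+ 2 * (Y a ^+ 2 + X a * Z a - delta)
        - X s * X a * (disc s - (2 * Y s * Y a + X s * Z a + Z s * X a))).
    by rewrite /disc; field; rewrite two_neq0 f0.
  by rewrite ea Sa' !subrr !mulr0 subr0.
(* With [disc s = 0], the equation [eD] would exhibit [delta] as a square. *)
have d0 : disc s != 0.
  apply: contraNneq (nonsquare ((X s * Y a - Y s * X a) / X s)) => d0.
  rewrite d0 !mul0r !subr0 in eD.
  by rewrite expr_div_n -eD mulrC mulKf ?expf_neq0.
have [e|k0] := eqVneq (X s ^+ 2 * (delta - disc s / 4)) 0; last first.
  have -> : (a == - b) = false.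
    apply: contraNF k0 => /eqP/dE[x y z]; rewrite /disc x y z -Sa'.
    by apply/eqP; field; rewrite f0.
  by rewrite addn0 card_conic.
have d4 : disc s = 4 * delta.
  move/eqP: e; rewrite mulf_eq0 expf_eq0 (negbTE s0) /= subr_eq0 => /eqP->.
  by rewrite mulrC divfK.
have -> : a == - b.
  (* Since [disc s = 4 * delta] is a nonsquare, [w^2 - disc s * t^2] vanishes only at the origin.
     Hence [a] is half of [s = a - b], that is, [a = - b]. *)
  have ns t : t ^+ 2 != disc s.
    by have := in_set0 t; rewrite -sqroots_nonsquare -d4 inE => ->.
  have x2 : X a = X s / 2.
    apply/eqP; rewrite -subr_eq0.
    have := ns ((X s * Y a - Y s * X a) / (X a - X s / 2)); apply: contraNT => x0.
    rewrite expr_div_n -[(_ - _) ^+ 2 in X in X / _](subrK (disc s * (X a - X s / 2) ^+ 2)).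
    by rewrite -eD e add0r mulfK // expf_neq0.
  have y2 : Y a = Y s / 2.
    have : (X s * Y a - Y s * X a) ^+ 2 == 0.
      by rewrite -(subrK (disc s * (X a - X s / 2) ^+ 2) (_ ^+ 2)) -eD e add0r x2 subrr expr0n mulr0.
    rewrite sqrf_eq0 subr_eq0 => /eqP h; apply: (mulfI s0); rewrite h x2; ring.
  have z2 : Z a = Z s / 2.
    apply: (mulfI s0); transitivity (disc s - 2 * Y s * Y a - Z s * X a).
      by rewrite -ea; ring.
    by rewrite x2 y2 /disc; field.
  have half (u v : F) : u = (u - v) / 2 -> u = - v.
    move=> uv; apply/eqP; rewrite -subr_eq0 opprK.
    rewrite (_ : u + v = 2 * (u - (u - v) / 2)); first by rewrite -uv subrr mulr0.
    by field.
  rewrite /s XB in x2; rewrite /s YB in y2; rewrite /s ZB in z2.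
  have [xb yb zb] := coordinatesN b; apply/eqP.
  by apply: coordinates_inj; rewrite ?xb ?yb ?zb; apply: half.
(* The singular conic is a single point and no tangent functional kills [s], so the total is
   [1 + 0 + q]. *)
by rewrite e card_conic0 // d4 sqroots_nonsquare cards0 muln0 !addn0 add1n.
Qed.

End EllipticQuadric.

(** * Cauchy-Schwarz for the energy *)

Section CauchySchwarz.
Variables (C : numClosedFieldType) (T : finType).

(** Writing the Cauchy-Schwarz defect as a sum of squares yields both the inequality and its
    equality case. *)
Lemma sum_sqr_dev (B : {set T}) (u : T -> C) :
  \sum_(a in B) `|#|B|%:R * u a - \sum_(b in B) u b| ^+ 2 =
  #|B|%:R * (#|B|%:R * \sum_(a in B) `|u a| ^+ 2 - `|\sum_(b in B) u b| ^+ 2).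
Proof.
set t := \sum_(b in B) u b; set n : C := #|B|%:R.
set m := `|t| ^+ 2.
have E a : `|n * u a - t| ^+ 2 =
    n ^+ 2 * `|u a| ^+ 2 - n * t^* * u a - n * t * (u a)^* + m.
  rewrite /m !normCK rmorphB rmorphM /= conjC_nat -/n; ring.
rewrite (eq_bigr _ (fun a _ => E a)) big_split /= sumr_const -mulr_natl -/n.
rewrite !sumrB -!mulr_sumr -rmorph_sum -/t /m normCK /=; ring.
Qed.

Lemma cauchy_schwarz (B : {set T}) (u : T -> C) :
  `|\sum_(a in B) u a| ^+ 2 <= #|B|%:R * \sum_(a in B) `|u a| ^+ 2.
Proof.
have [->|/set0Pn B0] := eqVneq B set0; first by rewrite !big_set0 normr0 expr0n mulr0.
have n0 : 0 < #|B|%:R :> C by rewrite ltr0n; apply/card_gt0P.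
rewrite -subr_ge0 -(pmulr_rge0 _ n0) -sum_sqr_dev.
by apply: sumr_ge0 => a _; rewrite exprn_ge0.
Qed.

Lemma cauchy_schwarz_eq (B : {set T}) (u : T -> C) :
  `|\sum_(a in B) u a| ^+ 2 = #|B|%:R * \sum_(a in B) `|u a| ^+ 2 ->
  {in B, forall a, u a = (\sum_(b in B) u b) / #|B|%:R}.
Proof.
move=> e a aB.
have n0 : #|B|%:R != 0 :> C by rewrite pnatr_eq0 -lt0n; apply/card_gt0P; exists a.
have := sum_sqr_dev B u; rewrite -e subrr mulr0 => /psumr_eq0P h.
have /eqP := h (fun a _ => exprn_ge0 2 (normr_ge0 _)) a aB.
by rewrite sqrf_eq0 normr_eq0 subr_eq0 => /eqP <-; rewrite mulrC mulKf.
Qed.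

Lemma sum_supp (B : {set T}) (u : T -> C) : (forall a, a \notin B -> u a = 0) ->
  \sum_a u a = \sum_(a in B) u a.
Proof.
move=> u0; rewrite (bigID (mem B)) /= [X in _ + X]big1 ?addr0 //.
Qed.

End CauchySchwarz.

Section Symmetrization.
Variables (C : numClosedFieldType) (V : finZmodType) (g : V -> C).

Definition evenpart a := (g a + g (- a)) / 2.

Lemma sum_oppr : \sum_a g (- a) = \sum_a g a.
Proof. by rewrite [RHS](reindex_inj oppr_inj). Qed.

Lemma sum_evenpart : \sum_a evenpart a = \sum_a g a.
Proof.
rewrite -mulr_suml big_split /= sum_oppr.
by apply: (canLR (mulfK _)); rewrite ?pnatr_eq0 // mulr_natr mulr2n.
Qed.

End Symmetrization.

(** Adding the two energy bounds pairs [g] with itself and with its reflection; only the even part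
    survives. *)
Lemma sum_sqr_evenpart (C : numClosedFieldType) (V : finZmodType) (g : V -> C) :
  \sum_a g a * g a + \sum_a g a * g (- a) = 2 * \sum_a evenpart g a ^+ 2.
Proof.
have E a : evenpart g a ^+ 2 = (g a ^+ 2 + 2 * (g a * g (- a)) + g (- a) ^+ 2) / 4.
  by rewrite /evenpart; field.
rewrite (eq_bigr _ (fun a _ => E a)) -mulr_suml !big_split /= -mulr_sumr.
rewrite (sum_oppr (fun a => g a ^+ 2)).
under [X in X + _]eq_bigr do rewrite -expr2.
by field.
Qed.

(** * The extremal energy problem for a symmetric set with [q + 1] functionals *)

Section Extremal.
Variables (C : numClosedFieldType) (V A : finZmodType) (I : finType).
Variables (S : {set V}) (l : I -> V -> A) (q : nat).
Hypothesis q_gt1 : (1 < q)%N.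
Hypothesis card_I : #|I| = q.+1.
Hypothesis card_A : #|A| = q.
Hypothesis SN : forall a, a \in S -> - a \in S.
Hypothesis S_neqN : forall a, a \in S -> a != - a.
Hypothesis lB : forall i, {morph l i : a b / a - b}.
Hypothesis l_neq0 : forall i a, a \in S -> l i a != 0.
Hypothesis card_fiber : forall i c, c != 0 -> #|[set a in S | l i a == c]| = q.
Hypothesis card_S : #|S| = (q.-1 * q)%N.

Definition shift_overlap (s : V) : {set V} := [set a in S | a - s \in S].

Hypothesis card_shift_overlap : forall a b, a \in S -> b \in S -> a != b ->
  (#|shift_overlap (a - b)%R| + #|[set i | l i (a - b) == 0]%R|
    + (if (a == - b)%R then q else 0) = q.+1)%N.

Definition supported (f : V -> C) := forall a, a \notin S -> f a = 0.

Definition fiber_sum (h : V -> C) i c := \sum_(a | l i a == c) h a.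

Lemma q_neq0 : q%:R != 0 :> C.
Proof. by rewrite pnatr_eq0 -lt0n ltnW. Qed.

Lemma predq_neq0 : q%:R - 1 != 0 :> C.
Proof. by rewrite subr_eq0 pnatr_eq1; case: q q_gt1 => [|[]]. Qed.

Lemma card_SE : #|S|%:R = (q%:R - 1) * q%:R :> C.
Proof. by rewrite card_S natrM -subn1 natrB // ltnW. Qed.

(** The indicator of [b != a] lets the identity be summed over all pairs: at [b = a] in [S] all
    [q + 1] functionals agree and [a != - a], so the right-hand side cancels to zero. *)
Lemma overlap_weight a b h k : supported h -> supported k ->
  (b != a)%:R * (#|shift_overlap (a - b)|%:R * (h a * k b)) =
  (q%:R + 1) * (h a * k b) - \sum_i (l i a == l i b)%:R * (h a * k b)
    - q%:R * ((b == - a)%:R * (h a * k b)) :> C.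
Proof.
move=> h0 k0; have [aS|/h0->] := boolP (a \in S); last first.
  by rewrite !(mul0r, mulr0) big1 ?subrr // => i _; rewrite mulr0.
have [bS|/k0->] := boolP (b \in S); last first.
  by rewrite !(mulr0) big1 ?subrr // => i _; rewrite mulr0.
rewrite -mulr_suml -natr_sum.
have -> : (\sum_i (l i a == l i b) = #|[set i | l i (a - b) == 0]%R|)%N.
  rewrite -sum1dep_card [RHS]big_mkcond /=; apply: eq_bigr => i _.
  by rewrite lB subr_eq0; case: (_ == _).
have [ab|ab] := eqVneq b a.
  rewrite ab subrr (_ : [set i | _] = setT); last first.
    by apply/setP => i; rewrite !inE -[X in l i X](subrr a) lB subrr eqxx.
  rewrite cardsT card_I.
  by rewrite (negbTE (S_neqN aS)) -natr1 /= !(mulr0n, mul0r, mulr0, subrr).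
rewrite eq_sym in ab; have := card_shift_overlap aS bS ab.
rewrite -[b == _]eqr_oppLR [- b == a]eq_sym => /(congr1 (fun n => n%:R : C)).
rewrite !natrD -natr1 => <-; case: (a == - b) => /=; ring.
Qed.

Lemma sum_overlap h k : supported h -> supported k ->
  \sum_a \sum_(b | b != a) #|shift_overlap (a - b)|%:R * (h a * k b) =
  (q%:R + 1) * (\sum_a h a) * (\sum_a k a)
  - \sum_i \sum_c fiber_sum h i c * fiber_sum k i c
  - q%:R * \sum_a h a * k (- a).
Proof.
move=> h0 k0.
transitivity (\sum_a \sum_b ((q%:R + 1) * (h a * k b)
   - \sum_i (l i a == l i b)%:R * (h a * k b)
    - q%:R * ((b == - a)%:R * (h a * k b)))).
  apply: eq_bigr => a _; rewrite big_mkcond /=; apply: eq_bigr => b _.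
  by rewrite -overlap_weight //; case: (_ != _); rewrite ?mul1r ?mul0r.
under eq_bigr do rewrite !sumrB.
rewrite !sumrB; congr (_ - _ - _).
- by rewrite -mulrA big_distrlr /= mulr_sumr; apply: eq_bigr => a _; rewrite mulr_sumr.
(* For each functional, pairs are grouped by their common value [c]. *)
- under eq_bigr do rewrite exchange_big /=.
  rewrite exchange_big; apply: eq_bigr => i _ /=.
  rewrite (partition_big (l i) xpredT) //=; apply: eq_bigr => c _.
  rewrite big_distrlr /=; apply: eq_bigr => a /eqP <-.
  rewrite [RHS]big_mkcond; apply: eq_bigr => b _; rewrite eq_sym.
  by case: (_ == _); rewrite ?mul1r ?mul0r.
- rewrite mulr_sumr; apply: eq_bigr => a _; rewrite -mulr_sumr; congr (_ * _).
  rewrite (bigD1 (- a)) //= eqxx mul1r big1 ?addr0 // => b /negbTE->.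
  by rewrite mul0r.
Qed.

Lemma sum_shift (w : V -> V -> C) :
  \sum_(s | s != 0) \sum_a w a (a - s) = \sum_a \sum_(b | b != a) w a b.
Proof.
rewrite exchange_big; apply: eq_bigr => a _ /=.
rewrite [RHS](reindex_inj (inj_comp (addrI a) oppr_inj)) /=.
by apply: eq_bigl => s; congr negb; rewrite -[RHS]subr_eq0 /= addrAC subrr add0r oppr_eq0.
Qed.

(** For [s != 0] the summand is supported on [shift_overlap s], whose size is the Cauchy-Schwarz
    factor; the term [s = 0] is kept exact. A reflected or conjugated copy of [f] as [g] covers both
    forms of the energy. *)
Lemma correlation_bound f g : supported f -> supported g ->
  \sum_s `|\sum_a f a * g (a - s)| ^+ 2 <=
  `|\sum_a f a * g a| ^+ 2 + \sum_a \sum_(b | b != a)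
     #|shift_overlap (a - b)|%:R * (`|f a| ^+ 2 * `|g b| ^+ 2).
Proof.
move=> f0 g0; rewrite (bigD1 0) //=; apply: lerD.
  by under eq_bigr do rewrite subr0.
rewrite -(sum_shift (fun a b => #|shift_overlap (a - b)|%:R * (`|f a| ^+ 2 * `|g b| ^+ 2))).
apply: ler_sum => s _.
have supp (w : V -> C) : (forall a, f a = 0 \/ g (a - s) = 0 -> w a = 0) ->
    \sum_a w a = \sum_(a in shift_overlap s) w a.
  move=> w0; apply: sum_supp => a; rewrite inE => /nandP[/f0|/g0] ?;
    apply: w0; [by left | by right].
rewrite [leRHS]supp => [|a [->|->]]; last first.
- by rewrite normr0 expr0n !mulr0.
- by rewrite normr0 expr0n mul0r mulr0.
rewrite [in leLHS]supp => [|a [->|->]]; rewrite ?mul0r ?mulr0 //.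
apply: le_trans (cauchy_schwarz _ _) _.
rewrite mulr_sumr; apply: ler_sum => a _.
by rewrite subKr normrM exprMn.
Qed.

(** * Upper bound and equality case for one function *)

Section Energy.
Variable f : V -> C.
Hypothesis f0 : supported f.
Let h a := `|f a| ^+ 2.
Let L := \sum_a h a.
(** [M ^+ 2] is the [s = 0] term of the convolution form of the energy, and [L ^+ 2] that of the
    correlation form. *)
Let M := `|\sum_a f a * f (- a)|.

Lemma fiber_sum_opp g i c : fiber_sum (fun a => g (- a)) i c = fiber_sum g i (- c).
Proof.
have lN a : l i (- a) = - l i a.
  by rewrite -[- a]sub0r -[in LHS](subrr a) !lB subrr sub0r.
rewrite /fiber_sum (reindex_inj oppr_inj) /=.
by apply: eq_big => a; rewrite ?opprK // lN eqr_oppLR.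
Qed.

Lemma sum_fiber_sum g i : \sum_c fiber_sum g i c = \sum_a g a.
Proof. by rewrite [RHS](partition_big (l i) xpredT). Qed.

Lemma fiber_sum0 g i : supported g -> fiber_sum g i 0 = 0.
Proof.
move=> g0; rewrite /fiber_sum big1 // => a /eqP la; apply: g0.
by apply/negP => /(l_neq0 i); rewrite la eqxx.
Qed.

Lemma supportedN g : supported g -> supported (fun a => g (- a)).
Proof. by move=> g0 a aS; apply: g0; apply: contra aS => /SN; rewrite opprK. Qed.

Let h0 : supported h.
Proof. by move=> a /f0 e; rewrite /h e normr0 expr0n. Qed.

Let h_ge0 a : 0 <= h a.
Proof. exact: exprn_ge0. Qed.

Let L_ge0 : 0 <= L.
Proof. exact: sumr_ge0. Qed.

(** Cauchy-Schwarz over the values [c]; the factor is [q - 1] because no point of [S] lies over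
    [c = 0]. *)
Lemma evenpart_fiber_sum_bound i :
  L ^+ 2 <= (q%:R - 1) * \sum_c evenpart (fiber_sum h i) c ^+ 2.
Proof.
have T_ge0 c : 0 <= fiber_sum h i c by apply: sumr_ge0.
have e_ge0 c : 0 <= evenpart (fiber_sum h i) c.
  by rewrite divr_ge0 ?addr_ge0 ?ler0n.
have e0 c : c \notin [set~ 0] -> evenpart (fiber_sum h i) c = 0.
  by rewrite !inE negbK => /eqP->; rewrite /evenpart oppr0 fiber_sum0 // addr0 mul0r.
have := cauchy_schwarz [set~ 0] (evenpart (fiber_sum h i)).
rewrite -(sum_supp e0) sum_evenpart sum_fiber_sum -/L ger0_norm //.
rewrite cardsC1 card_A -subn1 natrB ?(ltnW q_gt1) //.
congr (_ <= _ * _).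
rewrite [RHS](@sum_supp _ _ [set~ 0]) => [|c /e0->]; last by rewrite expr0n.
by apply: eq_bigr => c _; rewrite ger0_norm.
Qed.

(** The bounds from the two forms of the energy are added. The terms beyond [2 * E] on the left are
    nonnegative slack: dropping them gives [energy_le], their vanishing gives [energy_eq]. *)
Lemma energy_bound E :
  \sum_s `|\sum_a f a * f (s - a)| ^+ 2 = E ->
  \sum_s `|\sum_a f a * (f (a - s))^*| ^+ 2 = E ->
  2 * E + (L ^+ 2 - M ^+ 2)
    + 2 * q%:R * (\sum_a evenpart h a ^+ 2 - L ^+ 2 / #|S|%:R) <=
  2 * (q%:R + 1 - 3 * q%:R / #|S|%:R) * L ^+ 2.
Proof.
move=> E1 E2.
(* The convolution form is a correlation with the reflection of [f]. *)
have B1 : E <= M ^+ 2 + \sum_a \sum_(b | b != a)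
     #|shift_overlap (a - b)|%:R * (h a * h (- b)).
  rewrite -E1; apply: le_trans (correlation_bound f0 (supportedN f0)).
  rewrite le_eqVlt; apply/orP; left; apply/eqP; apply: eq_bigr => s _.
  by under [in RHS]eq_bigr do rewrite opprB.
have B2 : E <= L ^+ 2 + \sum_a \sum_(b | b != a)
     #|shift_overlap (a - b)|%:R * (h a * h b).
  rewrite -E2.
  have f0' : supported (fun a => (f a)^*) by move=> a /f0->; rewrite conjC0.
  apply: le_trans (correlation_bound f0 f0') _.
  under eq_bigr do rewrite -normCK; rewrite ger0_norm //.
  apply: lerD => //; apply: ler_sum => a _; apply: ler_sum => b _.
  by rewrite norm_conjC.
have T_opp i c : fiber_sum (fun a => h (- a)) i c = fiber_sum h i (- c).
  exact: fiber_sum_opp.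
have hN := supportedN h0.
set W := \sum_i \sum_c evenpart (fiber_sum h i) c ^+ 2.
set e := \sum_a evenpart h a ^+ 2.
have K12 : \sum_a (\sum_(b | b != a) #|shift_overlap (a - b)|%:R * (h a * h (- b)))
    + \sum_a (\sum_(b | b != a) #|shift_overlap (a - b)|%:R * (h a * h b))
    = 2 * (q%:R + 1) * L ^+ 2 - 2 * W - 2 * q%:R * e.
  rewrite (sum_overlap h0 hN) (sum_overlap h0 h0) (sum_oppr h) -/L.
  under [X in _ - _ * X + _]eq_bigr do rewrite opprK.
  under [X in _ - X - _ + _]eq_bigr do under eq_bigr do rewrite T_opp.
  have -> : 2 * W = \sum_i \sum_c fiber_sum h i c * fiber_sum h i c
      + \sum_i \sum_c fiber_sum h i c * fiber_sum h i (- c).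
    rewrite mulr_sumr -big_split; apply: eq_bigr => i _ /=.
    by rewrite sum_sqr_evenpart.
  rewrite -[2 * q%:R * e]mulrA [q%:R * e]mulrC [2 * (e * _)]mulrA -sum_sqr_evenpart.
  ring.
have W_ge : (q%:R + 1) * L ^+ 2 <= (q%:R - 1) * W.
  rewrite mulr_sumr natr1 -card_I mulr_natl -sumr_const.
  by apply: ler_sum => i _; apply: evenpart_fiber_sum_bound.
have {}B1 := lerD B1 B2; rewrite addrACA K12 in B1.
apply: le_trans (_ : (M ^+ 2 + L ^+ 2 + (2 * (q%:R + 1) * L ^+ 2 - 2 * W - 2 * q%:R * e)
   + (L ^+ 2 - M ^+ 2) + 2 * q%:R * (e - L ^+ 2 / #|S|%:R)) <= _).
  by rewrite !lerD2r mulr_natl mulr2n.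
have qp : 0 < q%:R - 1 :> C by rewrite subr_gt0 ltr1n.
rewrite -subr_ge0 card_SE.
(* As [|S| = (q - 1) q], the constant arises from [q + 2 - (q + 1) / (q - 1) - 1 / (q - 1) = q + 1 -
   3 / (q - 1)]. *)
have -> : 2 * (q%:R + 1 - 3 * q%:R / ((q%:R - 1) * q%:R)) * L ^+ 2 -
  (M ^+ 2 + L ^+ 2 + (2 * (q%:R + 1) * L ^+ 2 - 2 * W - 2 * q%:R * e)
   + (L ^+ 2 - M ^+ 2) + 2 * q%:R * (e - L ^+ 2 / ((q%:R - 1) * q%:R))) =
  2 / (q%:R - 1) * ((q%:R - 1) * W - (q%:R + 1) * L ^+ 2).
  by field; rewrite q_neq0 predq_neq0.
by rewrite mulr_ge0 ?subr_ge0 // divr_ge0 ?ler0n // ltW.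
Qed.

(** Expanding the squares gives [2 * (L - \sum_a |f a f(-a)|)], and the triangle inequality brings
    in [M]. So [M <= L], and equality forces [|f|] to be even. *)
Lemma antipodal_deviation : 2 * (L - M) >= \sum_a (`|f a| - `|f (- a)|) ^+ 2.
Proof.
have -> : \sum_a (`|f a| - `|f (- a)|) ^+ 2 = 2 * (L - \sum_a `|f a * f (- a)|).
  rewrite mulrBr mulr_natl mulr2n {2}/L -(sum_oppr h) /L -big_split /= mulr_sumr -sumrB.
  by apply: eq_bigr => a _; rewrite /h normrM; ring.
by rewrite ler_pM2l ?ltr0n // lerD2l lerN2; apply: ler_norm_sum.
Qed.

Lemma antipodal_product_le : M <= L.
Proof.
rewrite -subr_ge0 -(pmulr_rge0 _ (ltr0n C 2)); apply: le_trans antipodal_deviation.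
apply: sumr_ge0 => a _; rewrite real_exprn_even_ge0 //.
by rewrite rpredB ?normr_real.
Qed.

Let evenpart_supp a : a \notin S -> evenpart h a = 0.
Proof. by move=> aS; rewrite /evenpart h0 ?(supportedN h0) // addr0 mul0r. Qed.

Let evenpart_ge0 a : 0 <= evenpart h a.
Proof. by rewrite divr_ge0 ?addr_ge0 ?ler0n. Qed.

Let cardS_gt0 : 0 < #|S|%:R :> C.
Proof. by rewrite card_SE mulr_gt0 ?subr_gt0 ?ltr1n ?ltr0n // ltnW. Qed.

Let sum_evenpart_supp : `|\sum_(a in S) evenpart h a| = L.
Proof. by rewrite -(sum_supp evenpart_supp) sum_evenpart ger0_norm. Qed.

Let sum_sqr_evenpart_supp :
  \sum_(a in S) `|evenpart h a| ^+ 2 = \sum_a evenpart h a ^+ 2.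
Proof.
rewrite [RHS](@sum_supp _ _ S) => [|a /evenpart_supp->]; last by rewrite expr0n.
by apply: eq_bigr => a _; rewrite ger0_norm.
Qed.

Lemma sum_sqr_evenpart_ge : L ^+ 2 / #|S|%:R <= \sum_a evenpart h a ^+ 2.
Proof.
rewrite ler_pdivrMr // mulrC -sum_sqr_evenpart_supp -sum_evenpart_supp.
exact: cauchy_schwarz.
Qed.

Lemma energy_le E :
  \sum_s `|\sum_a f a * f (s - a)| ^+ 2 = E ->
  \sum_s `|\sum_a f a * (f (a - s))^*| ^+ 2 = E ->
  E <= (q%:R + 1 - 3 * q%:R / #|S|%:R) * L ^+ 2.
Proof.
have two_gt0 : 0 < 2 :> C by rewrite ltr0n.
move=> E1 E2; rewrite -(ler_pM2l two_gt0) mulrA.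
apply: le_trans (energy_bound E1 E2); rewrite -addrA lerDl addr_ge0 //.
  by rewrite subr_ge0 lerXn2r ?nnegrE ?normr_ge0 // antipodal_product_le.
by rewrite !mulr_ge0 ?ler0n // subr_ge0 sum_sqr_evenpart_ge.
Qed.

(** Both slack terms of [energy_bound] vanish. The first makes [|f|] even, so [h] is its own even
    part; the second is equality in Cauchy-Schwarz on [S], so [h] is constant there. *)
Lemma energy_eq E :
  \sum_s `|\sum_a f a * f (s - a)| ^+ 2 = E ->
  \sum_s `|\sum_a f a * (f (a - s))^*| ^+ 2 = E ->
  E = (q%:R + 1 - 3 * q%:R / #|S|%:R) * L ^+ 2 ->
  {in S, forall a, `|f a| ^+ 2 = L / #|S|%:R}.
Proof.
move=> E1 E2 E3 a aS; have := energy_bound E1 E2; rewrite E3 -[leRHS]mulrA -addrA gerDl.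
have M1 : 0 <= L ^+ 2 - M ^+ 2.
  by rewrite subr_ge0 lerXn2r ?nnegrE ?normr_ge0 // antipodal_product_le.
have e1 : 0 <= 2 * q%:R * (\sum_a evenpart h a ^+ 2 - L ^+ 2 / #|S|%:R).
  by rewrite !mulr_ge0 ?ler0n // subr_ge0 sum_sqr_evenpart_ge.
move=> le0; have : L ^+ 2 - M ^+ 2
    + 2 * q%:R * (\sum_a evenpart h a ^+ 2 - L ^+ 2 / #|S|%:R) == 0.
  by rewrite eq_le le0 addr_ge0.
rewrite paddr_eq0 // => /andP[].
rewrite subr_eq0 eqrXn2 ?normr_ge0 // => /eqP LM.
rewrite !mulf_eq0 pnatr_eq0 /= (negbTE q_neq0) /= subr_eq0 => /eqP ee.
have := antipodal_deviation; rewrite -LM subrr mulr0 => s0.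
have nn b : 0 <= (`|f b| - `|f (- b)|) ^+ 2.
  by rewrite real_exprn_even_ge0 // rpredB ?normr_real.
have s00 : \sum_a (`|f a| - `|f (- a)|) ^+ 2 = 0.
  by apply/le_anti; rewrite s0 sumr_ge0.
have /eqP := psumr_eq0P (fun b _ => nn b) s00 (erefl : xpredT a).
rewrite sqrf_eq0 subr_eq0 => /eqP fN.
have hE : evenpart h a = h a.
  by rewrite /evenpart /h -fN -mulr2n -[_ *+ 2]mulr_natr mulfK ?pnatr_eq0.
have := @cauchy_schwarz_eq _ _ S (evenpart h) _ a aS.
rewrite -(sum_supp evenpart_supp) sum_evenpart -/L hE; apply.
rewrite ger0_norm // sum_sqr_evenpart_supp ee mulrC divfK // gt_eqF //.
Qed.
End Energy.

Lemma energy_indicator :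
  \sum_s `|\sum_a (a \in S)%:R * (a - s \in S)%:R : C| ^+ 2 =
  (q%:R + 1 - 3 * q%:R / #|S|%:R) * #|S|%:R ^+ 2.
Proof.
pose o a : C := (a \in S)%:R.
have o0 : supported o by move=> a /negbTE aS; rewrite /o aS.
have oE s : \sum_a o a * o (a - s) = #|shift_overlap s|%:R.
  rewrite -sum1dep_card natr_sum [RHS]big_mkcond /=; apply: eq_bigr => a _.
  by rewrite /o -natrM mulnb; case: (_ && _).
have osum : \sum_a o a = #|S|%:R.
  rewrite -sum1_card natr_sum [RHS]big_mkcond /=; apply: eq_bigr => a _.
  by rewrite /o; case: (_ \in _).
have -> : \sum_s `|\sum_a o a * o (a - s)| ^+ 2 =
    #|S|%:R ^+ 2 + \sum_a \sum_(b | b != a) #|shift_overlap (a - b)|%:R * (o a * o b).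
  rewrite (bigD1 0) //= -(sum_shift (fun a b => #|shift_overlap (a - b)|%:R * (o a * o b))).
  congr (_ + _).
    rewrite -osum ger0_norm.
      congr (_ ^+ 2); apply: eq_bigr => a _; rewrite subr0 /o.
      by case: (_ \in _); rewrite ?mulr1 ?mulr0.
    by apply: sumr_ge0 => a _; rewrite -natrM ler0n.
  (* Only one factor of the squared overlap size is expanded, which produces the weighted pair sum
     of [sum_overlap]. *)
  apply: eq_bigr => s _; rewrite oE normr_nat expr2 -[X in _ * X]oE mulr_sumr.
  by apply: eq_bigr => a _; rewrite subKr.
rewrite sum_overlap // osum.
have -> : \sum_a o a * o (- a) = #|S|%:R.
  rewrite -osum; apply: eq_bigr => a _; rewrite /o.
  have [aS|_] := boolP (a \in S); last by rewrite mul0r.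
  by rewrite SN // mulr1.
have fo i c : c != 0 -> fiber_sum o i c = q%:R.
  move=> c0; rewrite -(card_fiber i c0) -sum1dep_card natr_sum /fiber_sum.
  rewrite big_mkcond [RHS]big_mkcond; apply: eq_bigr => a _ /=.
  by rewrite /o andbC; case: (_ == _) (_ \in _) => [] [].
have -> : \sum_i \sum_c fiber_sum o i c * fiber_sum o i c =
    (q%:R + 1) * ((q%:R - 1) * q%:R ^+ 2).
  rewrite natr1 -card_I mulr_natl -sumr_const; apply: eq_bigr => i _.
  rewrite (bigD1 0) //= fiber_sum0 // mul0r add0r.
  rewrite (eq_bigr (fun _ => q%:R ^+ 2)) => [|c c0]; last by rewrite fo // expr2.
  rewrite sumr_const -[LHS]mulr_natl; congr (_ * _).
  rewrite (_ : #|_| = q.-1) -?subn1 ?natrB // 1?ltnW //.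
  by rewrite subn1 -card_A -(cardsC1 (0 : A)); apply: eq_card => t; rewrite !inE.
rewrite card_SE; field; rewrite ?q_neq0 ?predq_neq0 //.
Qed.

End Extremal.

(** * Hyperbolic coordinates for ternary forms *)

Section TernaryForms.
Variable F : finFieldType.
Local Notation i0 := (@Ordinal 3 0 isT).
Local Notation i1 := (@Ordinal 3 1 isT).
Local Notation i2 := (@Ordinal 3 2 isT).

Lemma sum3 (g : 'I_3 -> F) : \sum_i g i = g i0 + g i1 + g i2.
Proof.
rewrite !big_ord_recl big_ord0 addr0 addrA.
by congr (g _ + g _ + g _); apply: val_inj.
Qed.

(** The explicit expansion lets [ring] verify the identity of [crossP]. *)
Lemma det_mx33 (M : 'M[F]_3) : \det M =
  M i0 i0 * (M i1 i1 * M i2 i2 - M i1 i2 * M i2 i1)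
  - M i0 i1 * (M i1 i0 * M i2 i2 - M i1 i2 * M i2 i0)
  + M i0 i2 * (M i1 i0 * M i2 i1 - M i1 i1 * M i2 i0).
Proof.
pose j0 := @Ordinal 2 0 isT; pose j1 := @Ordinal 2 1 isT.
have e2 (i j : 'I_2) : val i = val j -> i = j by apply: ord_inj.
have det2 (N : 'M[F]_2) : \det N = N j0 j0 * N j1 j1 - N j0 j1 * N j1 j0.
  rewrite (expand_det_row _ j0) !big_ord_recl big_ord0 /cofactor !det_mx11 !mxE /=.
  rewrite (e2 (lift j0 0) j1) // (e2 (lift ord0 ord0) j1) // (e2 (lift j1 0) j0) //.
  by rewrite (e2 ord0 j0) //= expr0 expr1; ring.
rewrite (expand_det_row _ i0) sum3 /cofactor !det2 !mxE /=.
have e (i j : 'I_3) : val i = val j -> i = j by apply: ord_inj.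
rewrite (e (lift i0 j0) i1) // (e (lift i0 j1) i2) // (e (lift i1 j0) i0) //.
rewrite (e (lift i1 j1) i2) // (e (lift i2 j0) i0) // (e (lift i2 j1) i1) //.
rewrite expr0 expr1 sqrrN expr1n; ring.
Qed.

Definition vec (x y z : F) : 'rV[F]_3 := \row_i nth 0 [:: x; y; z] i.

Lemma vecE x y z :
  (vec x y z 0 i0 = x) * (vec x y z 0 i1 = y) * (vec x y z 0 i2 = z).
Proof. by rewrite /vec !mxE. Qed.

Variable Q : 'M[F]_3.
Hypothesis two_neq0 : (2 : F) != 0.
Hypothesis Q_sym : Q^T = Q.

Definition polar (u v : 'rV[F]_3) : F := \sum_i \sum_k Q i k * u 0 i * v 0 k.

Lemma polar_sym u v : polar u v = polar v u.
Proof.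
rewrite /polar exchange_big; apply: eq_bigr => i _; apply: eq_bigr => k _ /=.
by rewrite -{1}Q_sym mxE mulrAC.
Qed.

Lemma polarDl u v w : polar (u + v) w = polar u w + polar v w.
Proof.
rewrite /polar -big_split; apply: eq_bigr => i _; rewrite -big_split.
by apply: eq_bigr => k _ /=; rewrite mxE; ring.
Qed.

Lemma polarZl c u w : polar (c *: u) w = c * polar u w.
Proof.
rewrite /polar mulr_sumr; apply: eq_bigr => i _; rewrite mulr_sumr.
by apply: eq_bigr => k _; rewrite mxE; ring.
Qed.

Lemma polarDr u v w : polar w (u + v) = polar w u + polar w v.
Proof. by rewrite !(polar_sym w) polarDl. Qed.

Lemma polarZr c u w : polar w (c *: u) = c * polar w u.
Proof. by rewrite !(polar_sym w) polarZl. Qed.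

Lemma qform_polar u : qform Q u = polar u u.
Proof. by []. Qed.

(* Completing squares reduces the claim to solving [b22 X^2 + Y^2 = c]. *)
Lemma isotropic_exists : exists2 u, u != 0 & qform Q u = 0.
Proof.
have [q10 q20 q21] : [/\ Q i1 i0 = Q i0 i1, Q i2 i0 = Q i0 i2 & Q i2 i1 = Q i1 i2].
  by split; rewrite -[in LHS]Q_sym mxE.
have qE x y z : qform Q (vec x y z) = Q i0 i0 * x ^+ 2 + Q i1 i1 * y ^+ 2
    + Q i2 i2 * z ^+ 2 + 2 * Q i0 i1 * x * y + 2 * Q i0 i2 * x * z + 2 * Q i1 i2 * y * z.
  rewrite /qform sum3 !sum3 !vecE.
  by rewrite q10 q20 q21; ring.
have vec0 x y z : vec x y z = 0 -> [/\ x = 0, y = 0 & z = 0].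
  have := vecE x y z => /[swap] -> [[<- <-] <-]; by rewrite !mxE.
set a := Q i0 i0 in qE *; set b := Q i1 i1 in qE *; set c := Q i2 i2 in qE *.
set d := Q i0 i1 in qE *; set e := Q i0 i2 in qE *; set f := Q i1 i2 in qE *.
have [a0|a0] := eqVneq a 0.
  exists (vec 1 0 0); last by rewrite qE a0; ring.
  by apply/eqP => /vec0[/eqP]; rewrite oner_eq0.
have [b0|b0] := eqVneq (a * b - d ^+ 2) 0.
  exists (vec (- d / a) 1 0).
    by apply/eqP => /vec0[_ /eqP]; rewrite oner_eq0.
  rewrite qE; transitivity ((a * b - d ^+ 2) / a); first by field.
  by rewrite b0 mul0r.
(* With [z = 1], [X = a x + d y + e] and [Y = (a b - d^2) y + (a f - d e)], multiplying the form by
   [a (a b - d^2)] gives [(a b - d^2) X^2 + Y^2] plus a constant. *)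
have [X [Y XY]] := binary_form_universal
  (- ((a * b - d ^+ 2) * (a * c - e ^+ 2) - (a * f - d * e) ^+ 2)) b0 (oner_neq0 F).
pose y := (Y - (a * f - d * e)) / (a * b - d ^+ 2).
exists (vec ((X - d * y - e) / a) y 1).
  by apply/eqP => /vec0[_ _ /eqP]; rewrite oner_eq0.
rewrite qE; transitivity (((a * b - d ^+ 2) * X ^+ 2 + 1 * Y ^+ 2
   - - ((a * b - d ^+ 2) * (a * c - e ^+ 2) - (a * f - d * e) ^+ 2))
   / (a * (a * b - d ^+ 2))); last by rewrite XY subrr mul0r.
by rewrite /y; field; rewrite a0 b0.
Qed.

(** Nondegeneracy supplies [w0] with [polar u w0 = 1]; subtracting [qform Q w0 / 2] times the
    isotropic [u] makes it isotropic too. *)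
Lemma hyperbolic_pair : Q \in unitmx ->
  exists u w, [/\ qform Q u = 0, qform Q w = 0 & polar u w = 1].
Proof.
move=> Qu; have [u u0 qu] := isotropic_exists.
have /rV0Pn[k uk] : u *m Q != 0.
  by apply: contraNneq u0 => /(congr1 (mulmx^~ (invmx Q))); rewrite mulmxK // mul0mx => ->.
pose w0 : 'rV[F]_3 := ((u *m Q) 0 k)^-1 *: delta_mx 0 k.
have uw0 : polar u w0 = 1.
  rewrite polarZr -[RHS](mulVf uk); congr (_ * _).
  rewrite /polar exchange_big (bigD1 k) //= [X in _ + X]big1 ?addr0.
    by rewrite [in RHS]mxE; apply: eq_bigr => i _; rewrite !mxE !eqxx mulr1 mulrC.
  by move=> i ik; apply: big1 => i' _; rewrite mxE (negbTE ik) andbF mulr0.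
clearbody w0; exists u, (w0 + (- qform Q w0 / 2) *: u); split=> //.
2: by rewrite polarDr polarZr uw0 -qform_polar qu mulr0 addr0.
rewrite qform_polar polarDl !polarDr !polarZl !polarZr (polar_sym w0 u) uw0.
by rewrite -!qform_polar qu; field.
Qed.

(** The usual cross product of [u *m Q] and [w *m Q], which is therefore orthogonal to [u] and [w]
    for [polar]. *)
Definition cross (u w : 'rV[F]_3) : 'rV[F]_3 :=
  let p i := (u *m Q) 0 i in let r i := (w *m Q) 0 i in
  vec (p i1 * r i2 - p i2 * r i1) (p i2 * r i0 - p i0 * r i2)
      (p i0 * r i1 - p i1 * r i0).

(** The last equation is a Gram determinant identity; on a hyperbolic pair it gives the value
    [- \det Q]. *)
Lemma crossP u w : [/\ polar u (cross u w) = 0, polar w (cross u w) = 0 &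
  qform Q (cross u w) = \det Q * (qform Q u * qform Q w - polar u w ^+ 2)].
Proof.
have [q10 q20 q21] : [/\ Q i1 i0 = Q i0 i1, Q i2 i0 = Q i0 i2 & Q i2 i1 = Q i1 i2].
  by split; rewrite -[in LHS]Q_sym mxE.
rewrite /cross; set p := _ *m _; set r := _ *m _.
have pE k : p 0 k = u 0 i0 * Q i0 k + u 0 i1 * Q i1 k + u 0 i2 * Q i2 k.
  by rewrite mxE sum3.
have rE k : r 0 k = w 0 i0 * Q i0 k + w 0 i1 * Q i1 k + w 0 i2 * Q i2 k.
  by rewrite mxE sum3.
by rewrite det_mx33 /qform /polar !sum3 !vecE !pE !rE q10 q20 q21; split; ring.
Qed.

(** Let [g] be the cross product of a hyperbolic pair [u], [w], and [d = \det Q]. At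
    [v = alpha u + beta g + gamma w] the form is [2 alpha gamma - d beta^2]; multiplying by [- d]
    suggests [X = - 2 d alpha], [Y = d beta], [Z = gamma]. *)
Lemma hyperbolic_coordinates : Q \in unitmx ->
  exists (X Y Z : 'rV[F]_3 -> F) (mk : F -> F -> F -> 'rV[F]_3),
  [/\ [/\ {morph X : u v / u - v}, {morph Y : u v / u - v} & {morph Z : u v / u - v}],
      [/\ forall x y z, X (mk x y z) = x, forall x y z, Y (mk x y z) = y
        & forall x y z, Z (mk x y z) = z],
      forall v, mk (X v) (Y v) (Z v) = v
    & forall v, Y v ^+ 2 + X v * Z v = - \det Q * qform Q v].
Proof.
move=> Qu; have [u [w [qu qw uw]]] := hyperbolic_pair Qu.
have [ug wg qg] := crossP u w; set g := cross u w in ug wg qg.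
rewrite qu qw uw mul0r sub0r expr1n mulrN1 in qg.
rewrite !qform_polar in qu qw qg.
have wu : polar w u = 1 by rewrite polar_sym.
have gu : polar g u = 0 by rewrite polar_sym.
have gw : polar g w = 0 by rewrite polar_sym.
have d0 : \det Q != 0 by move: Qu; rewrite unitmxE unitfE.
set d := \det Q in qg d0 *.
pose X v := - 2 * d * polar w v; pose Y v := - polar g v; pose Z v := polar u v.
pose mk x y z := (- x / (2 * d)) *: u + (y / d) *: g + z *: w.
have polarB t : {morph polar t : v v' / v - v'}.
  by move=> v v'; rewrite -scaleN1r polarDr polarZr mulN1r.
have mkE t x y z : polar t (mk x y z) =
    - x / (2 * d) * polar t u + y / d * polar t g + z * polar t w.
  by rewrite !polarDr !polarZr.
have mkX x y z : X (mk x y z) = x.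
  by rewrite /X mkE wg wu qw; field; rewrite two_neq0 d0.
have mkY x y z : Y (mk x y z) = y.
  by rewrite /Y mkE gu gw qg; field; rewrite two_neq0 d0.
have mkZ x y z : Z (mk x y z) = z.
  by rewrite /Z mkE ug uw qu; field; rewrite two_neq0 d0.
pose mk3 (p : F * F * F) := mk p.1.1 p.1.2 p.2.
have mkI : injective mk3.
  move=> [[x y] z] [[x' y'] z'] e.
  have := congr1 Z e; have := congr1 Y e; have := congr1 X e.
  by rewrite /mk3 /= !mkX !mkY !mkZ => -> -> ->.
(* Injectivity and equal cardinalities replace a proof that [u], [g], [w] span the space. *)
have [co _ coK] : bijective mk3.
  by apply: inj_card_bij mkI _; rewrite card_mx !card_prod mul1n !expnS expn0 muln1 mulnA.
have mkK v : mk (X v) (Y v) (Z v) = v.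
  by rewrite -(coK v) /mk3 mkX mkY mkZ.
exists X, Y, Z, mk; split=> //.
  split=> v v'; rewrite /X /Y /Z polarB; ring.
move=> v; rewrite -{4}(mkK v) qform_polar mkE !(polar_sym (mk _ _ _)) !mkE.
rewrite ug wg gu gw uw wu qu qw qg; field; rewrite two_neq0 d0 //.
Qed.

End TernaryForms.

(** * Fourier analysis *)

Section Fourier.
Variables (R : realType) (F : finFieldType) (chi : F -> R[i]).
Hypothesis chi_char : additive_character chi.
Hypothesis chi_nonprincipal : nonprincipal chi.
Local Notation V := ('rV[F]_3).
Local Notation C := (R[i]).

Lemma dotDl (a b x : V) : dot (a + b) x = dot a x + dot b x.
Proof. by rewrite /dot -big_split; apply: eq_bigr => i _; rewrite mxE mulrDl. Qed.

Lemma dotDr (a x y : V) : dot a (x + y) = dot a x + dot a y.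
Proof. by rewrite /dot -big_split; apply: eq_bigr => i _; rewrite mxE mulrDr. Qed.

Lemma chiD x y : chi (x + y) = chi x * chi y.
Proof. by have [_] := chi_char; apply. Qed.

Lemma chi_neq0 x : chi x != 0.
Proof. by rewrite -normr_eq0; have [-> _] := chi_char; rewrite oner_eq0. Qed.

Lemma chi0 : chi 0 = 1.
Proof. by apply: (mulfI (chi_neq0 0)); rewrite -chiD addr0 mulr1. Qed.

Lemma chiN x : chi (- x) = (chi x)^*.
Proof.
apply: (mulfI (chi_neq0 x)); rewrite -chiD subrr chi0 -normCK.
by have [-> _] := chi_char; rewrite expr1n.
Qed.

(** For [a != 0] a translation of [x] multiplies the sum by a value of [chi] other than [1]. *)
Lemma chi_orthogonality (a : V) :
  \sum_x chi (dot a x) = (a == 0)%:R * #|F|%:R ^+ 3.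
Proof.
have [->|/rV0Pn[i ai]] := eqVneq a 0.
  have e x : chi (dot 0 x) = 1.
    by rewrite /dot big1 ?chi0 // => i _; rewrite mxE mul0r.
  by rewrite (eq_bigr _ (fun x _ => e x)) sumr_const card_mx mul1n mul1r natrX.
have [t chit] := chi_nonprincipal.
pose y : V := (t / a 0 i) *: delta_mx 0 i.
have ay : dot a y = t.
  rewrite /dot (bigD1 i) //= big1 ?addr0; first by rewrite !mxE !eqxx mulr1 mulrC divfK.
  by move=> k /negbTE ki; rewrite !mxE ki andbF !mulr0.
rewrite mul0r; set s := \sum_x _.
have : s = chi t * s.
  rewrite {1}/s (reindex_inj (addrI y)) /s mulr_sumr.
  by apply: eq_bigr => x _; rewrite dotDr ay chiD.
move/eqP; rewrite -subr_eq0 -{1}[s]mul1r -mulrBl mulf_eq0 subr_eq0.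
by case/orP=> /eqP // e; case: chit.
Qed.

Definition fourier (g : V -> C) x := \sum_a g a * chi (dot a x).

Lemma parseval g : \sum_x `|fourier g x| ^+ 2 = #|F|%:R ^+ 3 * \sum_a `|g a| ^+ 2.
Proof.
have E x : `|fourier g x| ^+ 2 =
    \sum_a \sum_b g a * (g b)^* * chi (dot (a - b) x).
  rewrite normCK rmorph_sum big_distrlr; apply: eq_bigr => a _.
  apply: eq_bigr => b _ /=; rewrite dotDl chiD rmorphM /= -chiN.
  have -> : dot (- b) x = - dot b x.
    by rewrite /dot -sumrN; apply: eq_bigr => i _; rewrite mxE mulNr.
  by rewrite mulrACA.
rewrite (eq_bigr _ (fun x _ => E x)) exchange_big mulr_sumr.
apply: eq_bigr => a _ /=; rewrite exchange_big (bigD1 a) //= -mulr_sumr.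
rewrite chi_orthogonality subrr eqxx mul1r -normCK mulrC big1 ?addr0 // => b ba.
by rewrite -mulr_sumr chi_orthogonality subr_eq0 eq_sym (negbTE ba) mul0r mulr0.
Qed.

Lemma fourierM f g x : fourier f x * fourier g x =
  fourier (fun s => \sum_a f a * g (s - a)) x.
Proof.
rewrite /fourier big_distrlr /=.
under [RHS]eq_bigr do rewrite mulr_suml.
rewrite [RHS]exchange_big; apply: eq_bigr => a _ /=.
rewrite [RHS](reindex_inj (addrI a)); apply: eq_bigr => b _ /=.
by rewrite addrAC subrr add0r dotDl chiD mulrACA.
Qed.

Lemma fourier_conj f x : (fourier f x)^* = fourier (fun a => (f (- a))^*) x.
Proof.
rewrite /fourier rmorph_sum (reindex_inj oppr_inj); apply: eq_bigr => a _ /=.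
rewrite rmorphM /= -chiN; congr (_ * chi _).
by rewrite /dot -sumrN; apply: eq_bigr => i _; rewrite mxE mulNr opprK.
Qed.

(** Parseval applied to the square of the transform, which is the transform of a convolution. *)
Lemma fourier_L4 f : \sum_x `|fourier f x| ^+ 4 =
  #|F|%:R ^+ 3 * \sum_s `|\sum_a f a * f (s - a)| ^+ 2.
Proof.
rewrite -parseval; apply: eq_bigr => x _.
by rewrite -fourierM normrM -expr2 -exprM.
Qed.

(** Parseval applied to the transform times its conjugate, which is the transform of an
    autocorrelation. *)
Lemma fourier_L4_conj f : \sum_x `|fourier f x| ^+ 4 =
  #|F|%:R ^+ 3 * \sum_s `|\sum_a f a * (f (a - s))^*| ^+ 2.
Proof.
rewrite -parseval; apply: eq_bigr => x _.
transitivity (`|fourier f x * (fourier f x)^*| ^+ 2).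
  by rewrite normrM norm_conjC -expr2 -exprM.
rewrite fourier_conj fourierM; congr (`|_| ^+ 2); apply: eq_bigr => s _.
by under eq_bigr do rewrite opprB.
Qed.

Variable S : {set V}.
Implicit Type f : {xi | xi \in S} -> C.

Definition extend0 f a : C := if insub a is Some u then f u else 0.

Lemma extend0_val f u : extend0 f (val u) = f u.
Proof. by rewrite /extend0 valK. Qed.

Lemma extend0_supp f a : a \notin S -> extend0 f a = 0.
Proof. by move=> aS; rewrite /extend0 insubN. Qed.

Lemma sum_extend0 (G : C -> V -> C) f : (forall a, G 0 a = 0) ->
  \sum_u G (f u) (val u) = \sum_a G (extend0 f a) a.
Proof.
move=> G0; rewrite [RHS](bigID (mem S)) /= [X in _ + X]big1 ?addr0; last first.
  by move=> a /extend0_supp->; rewrite G0.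
rewrite [RHS]big_sub; apply: eq_bigr => u _; by rewrite extend0_val.
Qed.

Lemma L4norm_extension f : L4norm (extension chi f) ^+ 4 =
  #|S|%:R ^- 4 * \sum_x `|fourier (extend0 f) x| ^+ 4.
Proof.
rewrite /L4norm rootCK // mulr_sumr; apply: eq_bigr => x _.
rewrite /extension (@sum_extend0 (fun z a => z * chi (dot a x))) => [|a]; last by rewrite mul0r.
by rewrite normrM exprMn normfV normr_nat exprVn.
Qed.

Lemma L2norm_extend0 f : L2norm f ^+ 4 =
  #|S|%:R ^- 2 * (\sum_a `|extend0 f a| ^+ 2) ^+ 2.
Proof.
rewrite /L2norm (exprM _ 2 2) sqrtCK exprMn exprVn.
by rewrite (@sum_extend0 (fun z _ => `|z| ^+ 2)) // => a; rewrite normr0 expr0n.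
Qed.

End Fourier.

(** * Energy on the quadric *)

Section QuadricEnergy.
Variables (R : realType) (F : finFieldType).
Variables (Q : 'M[F]_3) (j : F).
Hypothesis two_neq0 : (2 : F) != 0.
Hypothesis Q_sym : Q^T = Q.
Hypothesis Q_unit : Q \in unitmx.
Hypothesis nonsquare : forall t, t ^+ 2 != - j * \det Q.
Local Notation V := ('rV[F]_3).
Local Notation C := (R[i]).
Local Notation S := (quadric Q j).
Local Notation q := (#|F|).
Local Notation cst := (q%:R + 1 - 3 * q%:R / #|S|%:R : C).

(** Multiplying [qform Q v = j] by [- \det Q] gives the elliptic quadric with
    [delta = - j * \det Q], which meets the assumptions of the extremal problem with functionals
    indexed by [option F]. *)
Lemma quadric_energy :
  [/\ (0 < #|S|)%N,
      forall (f : V -> C) E, (forall a, a \notin S -> f a = 0) ->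
        \sum_s `|\sum_a f a * f (s - a)| ^+ 2 = E ->
        \sum_s `|\sum_a f a * (f (a - s))^*| ^+ 2 = E ->
        E <= cst * (\sum_a `|f a| ^+ 2) ^+ 2 /\
        (E = cst * (\sum_a `|f a| ^+ 2) ^+ 2 ->
         {in S, forall a, `|f a| ^+ 2 = (\sum_a `|f a| ^+ 2) / #|S|%:R})
    & \sum_s `|\sum_a (a \in S)%:R * (a - s \in S)%:R : C| ^+ 2 =
      cst * #|S|%:R ^+ 2].
Proof.
have [X [Y [Z [mk [[XB YB ZB] [mkX mkY mkZ] mkK eQ]]]]] :=
  hyperbolic_coordinates two_neq0 Q_sym Q_unit.
have d0 : \det Q != 0 by move: Q_unit; rewrite unitmxE unitfE.
have SE : S = ellquad X Y Z (- j * \det Q).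
  apply/setP => v; rewrite !inE eQ (_ : - j * _ = - \det Q * j); last by ring.
  by rewrite (inj_eq (mulfI _)) // oppr_eq0.
have q1 : (1 < q)%N by apply: card_finNzRing_gt1.
have cardI : #|{: option F}| = q.+1 by rewrite card_option.
have SN a : a \in S -> - a \in S by rewrite SE; apply: ellquadN.
have S2 a : a \in S -> a != - a.
  rewrite SE => aS; rewrite -subr_eq0 opprK.
  apply: contraNneq (mulf_neq0 two_neq0 (ellquad_X nonsquare aS)) => e.
  have [XN _ _] := coordinatesN XB YB ZB a.
  have [X0 _ _] := coordinates0 XB YB ZB.
  by rewrite mulr_natl mulr2n -{2}[X a]opprK -XN -XB opprK e X0.
have lB := tangentB XB YB ZB.
have l0 i a : a \in S -> tangent X Y Z i a != 0.
  by rewrite SE; apply: tangent_neq0.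
have fib i c : c != 0 -> #|[set a in S | tangent X Y Z i a == c]| = q.
  by rewrite SE; apply: card_tangent_fiber.
have cS : #|S| = (q.-1 * q)%N by rewrite SE; apply: card_ellquad.
have ov a b : a \in S -> b \in S -> a != b ->
    (#|shift_overlap S (a - b)%R| + #|[set i | tangent X Y Z i (a - b) == 0]%R|
      + (if (a == - b)%R then q else 0) = q.+1)%N.
  by rewrite /shift_overlap SE; apply: card_overlap_tangent.
split=> [|f E f0 E1 E2|].
- by rewrite cS muln_gt0 !lt0n; case: q q1 => [|[]].
- split=> [|E3]; first exact: (energy_le q1 cardI erefl SN S2 lB l0 cS ov f0 E1 E2).
  exact: (energy_eq q1 cardI erefl SN S2 lB l0 cS ov f0 E1 E2 E3).
- exact: (energy_indicator C q1 cardI erefl SN S2 lB l0 fib cS ov).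
Qed.

End QuadricEnergy.

(** * From the energy to the norm inequality *)

Theorem theorem1p2 (R : realType) (F : finFieldType) (p : nat)
    (charFp : p \in [pchar F]) (odd_p : odd p)
    (chi : F -> R[i]) (chi_char : additive_character chi)
    (chi_nonprincipal : nonprincipal chi)
    (Q : 'M[F]_3) (Q_sym : Q^T = Q) (Q_nondeg : Q \in unitmx) (j : F)
    (nz : - j * \det Q != 0)
    (nsq : ~ exists2 a : F, a != 0 & a ^+ 2 = - j * \det Q) :
  let S := quadric Q j in
  [/\ forall f : {xi | xi \in S} -> R[i],
        L4norm (extension chi f) ^+ 4 <= sharp_constant R S * L2norm f ^+ 4,
      forall K : R[i], K < sharp_constant R S ->
        ~ (forall f : {xi | xi \in S} -> R[i],
             L4norm (extension chi f) ^+ 4 <= K * L2norm f ^+ 4),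
      forall (c : R[i]) (f : {xi | xi \in S} -> R[i]), (forall xi, f xi = c) ->
        L4norm (extension chi f) ^+ 4 = sharp_constant R S * L2norm f ^+ 4
    & forall f : {xi | xi \in S} -> R[i], maximizer chi f ->
        exists r : R[i], forall xi, `|f xi| = r].
Proof.
move=> S.
have two_neq0 : (2 : F) != 0.
  rewrite -(dvdn_pcharf charFp); apply: contraL odd_p => p2.
  by rewrite (eqP (_ : p == 2%N)) // -dvdn_prime2 // (pcharf_prime charFp).
have nonsquare t : t ^+ 2 != - j * \det Q.
  apply/eqP => e; apply: nsq; exists t => //; apply: contra_neq nz => t0.
  by rewrite -e t0 expr0n.
have [S0 bound ind] := quadric_energy R two_neq0 Q_sym Q_nondeg nonsquare.
rewrite -/S in S0 bound ind.
set n : R[i] := #|S|%:R; set q : R[i] := #|F|%:R.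
have n0 : n != 0 by rewrite pnatr_eq0 -lt0n.
have q0 : q != 0 by rewrite pnatr_eq0 -lt0n ltnW // card_finNzRing_gt1.
pose En (f : {xi | xi \in S} -> R[i]) :=
  \sum_s `|\sum_a extend0 f a * extend0 f (s - a)| ^+ 2.
(* Multiplied by [q ^+ 3], both sums are the same fourth moment of the transform. *)
have En_conj f : \sum_s `|\sum_a extend0 f a * (extend0 f (a - s))^*| ^+ 2 = En f.
  apply: (mulfI (expf_neq0 3 q0)).
  by rewrite -(fourier_L4_conj chi_char) // -(fourier_L4 chi_char).
pose L f := \sum_a `|extend0 (S := S) f a| ^+ 2 : R[i].
pose k : R[i] := q + 1 - 3 * q / n.
have lhsE f : L4norm (extension chi f) ^+ 4 = q ^+ 3 / n ^+ 4 * En f.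
  by rewrite L4norm_extension fourier_L4 // mulrA [n ^- 4 * _]mulrC.
have rhsE f : sharp_constant R S * L2norm f ^+ 4 = q ^+ 3 / n ^+ 4 * (k * L f ^+ 2).
  rewrite L2norm_extend0 /sharp_constant -/n -/q -/k -/(L f).
  by rewrite (exprM n 2 2); field; rewrite n0.
have w_gt0 : 0 < q ^+ 3 / n ^+ 4.
  by rewrite divr_gt0 ?exprn_gt0 // lt0r ?n0 ?q0 ler0n.
have sharp c (f : {xi | xi \in S} -> R[i]) : (forall xi, f xi = c) ->
    L4norm (extension chi f) ^+ 4 = sharp_constant R S * L2norm f ^+ 4.
  (* A constant [c] scales the energy of the indicator, and likewise [L f ^+ 2], by [|c|^4]. *)
  move=> fc; rewrite lhsE rhsE; congr (_ * _).
  have fE a : extend0 f a = c * (a \in S)%:R.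
    have [aS|aS] := boolP (a \in S); last by rewrite extend0_supp // mulr0.
    by rewrite -[a]/(val (exist (fun x => x \in S) a aS)) extend0_val fc mulr1.
  have LE : L f = `|c| ^+ 2 * n.
    rewrite /L /n -sum1_card natr_sum mulr_sumr [RHS]big_mkcond /=.
    apply: eq_bigr => a _; rewrite fE.
    by case: (_ \in _); rewrite ?mulr1 // mulr0 normr0 expr0n.
  rewrite -En_conj LE exprMn mulrCA -[k * _]ind mulr_sumr.
  apply: eq_bigr => s _; rewrite -[in RHS](ger0_norm (exprn_ge0 2 (normr_ge0 c))).
  rewrite -exprMn -normrM mulr_sumr; congr (`|_| ^+ 2).
  apply: eq_bigr => a _; rewrite !fE rmorphM /= conjC_nat normCK.
  by rewrite mulrACA.
split=> [f|K Klt le_K|//|f [_ fmax]].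
- rewrite lhsE rhsE ler_pM2l //.
  by have [] := bound _ _ (@extend0_supp _ _ _ f) erefl (En_conj f).
(* The constant function [1] has [L2norm] equal to [1] and attains equality, so it refutes any
   smaller [K]. *)
- have := le_K (fun=> 1); rewrite (sharp 1) // ler_pM2r ?(lt_geF Klt) //.
  have -> : L2norm (fun _ : {xi | xi \in S} => 1 : R[i]) = 1.
    rewrite /L2norm normr1 expr1n sumr_const card_sig.
    by rewrite mulVf // sqrtC1.
  by rewrite expr1n.
- have [_ eqf] := bound _ _ (@extend0_supp _ _ _ f) erefl (En_conj f).
  exists (sqrtC (L f / n)) => xi; rewrite -(extend0_val f).
  rewrite -(eqf _ (val xi) (valP xi)).
    by rewrite sqrCK.
  (* Cancelling the common positive factor turns maximality into equality in the energy bound. *)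
  by move: fmax; rewrite lhsE rhsE => /(mulfI (lt0r_neq0 w_gt0)).
Qed.
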